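(* For all $k\le n$ and every simple graph with $n$ vertices, $$I(\overline{K}_k)=\sum_{A\subseteq K_k}(-1)^{|A|}\binom{n-cv(A)}{k-cv(A)}I(A),$$ where the sum is over all unlabeled subgraphs $A$ of the complete graph $K_k$ (isomorphism classes of graphs without isolated vertices contained in $K_k$, including the empty graph).
   Context: Graphs are finite and simple. For a graph $h$, $I(\overline{K}_k)(h)$ denotes the number of independent sets of order $k$ in $h$, and $I(A)(h)$ the number of (not necessarily induced) subgraphs of $h$ isomorphic to $A$, with $I(\emptyset)=1$ for the empty graph. The identity is between functions of the graph $h$ on $n$ vertices. $|A|$ is the number of edges of $A$ and $cv(A)$ is the number of vertices connected to edges of $A$. *)

(* Defs.v *)
From HB Require Import structures.
From mathcomp Require Import all_boot all_order all_algebra.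

Set Implicit Arguments.
Unset Strict Implicit.
Unset Printing Implicit Defensive.

Record sgraph := SGraph {
  vertex :> finType;
  adj : rel vertex;
  adj_sym : symmetric adj;
  adj_irr : irreflexive adj }.

Definition edges (G : sgraph) : {set {set G}} :=
  [set E | [exists x, exists y, adj x y && (E == [set x; y])]].

Definition nedges (G : sgraph) : nat := #|edges G|.

Definition cv (G : sgraph) : nat := #|[set x : G | [exists y, adj x y]]|.

Definition no_isolated (G : sgraph) : bool := [forall x : G, exists y, adj x y].

Definition complete (k : nat) : sgraph :=
  @SGraph 'I_k (fun x y => x != y)
    (fun x y => congr1 negb (eq_sym x y)) (fun x => congr1 negb (eqxx x)).

Definition graph_iso (G H : sgraph) : bool :=
  [exists f : {ffun G -> H},
    [&& injectiveb f, [forall y, y \in codom f]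
      & [forall x, forall y, adj (f x) (f y) == adj x y]]].

Lemma graph_isoP (G H : sgraph) :
  reflect (exists2 f : G -> H, bijective f & {mono f : x y / adj x y})
          (graph_iso G H).
Proof.
apply: (iffP existsP) => [[f /and3P[/injectiveP fI /forallP fS /forallP fM]]|].
  exists f; last by move=> x y; apply/eqP/(forallP (fM x)).
  exists (fun y => iinv (fS y)) => [x|y]; last exact: f_iinv.
  by apply: fI; rewrite f_iinv.
case=> f [g fK gK] fM; exists [ffun x => f x]; apply/and3P; split.
- by apply/injectiveP => x y; rewrite !ffunE => /(can_inj fK).
- by apply/forallP=> y; apply/codomP; exists (g y); rewrite ffunE gK.
- by apply/forallP=> x; apply/forallP=> y; rewrite !ffunE fM.
Qed.

Lemma graph_iso_refl (G : sgraph) : graph_iso G G.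
Proof. by apply/graph_isoP; exists id => //; exists id. Qed.

Lemma graph_iso_sym (G H : sgraph) : graph_iso G H = graph_iso H G.
Proof.
apply/graph_isoP/graph_isoP => -[f [g fK gK] fM];
  by exists g; [exists f | move=> x y; rewrite -fM !gK].
Qed.

Lemma graph_iso_trans (G H K : sgraph) :
  graph_iso G H -> graph_iso H K -> graph_iso G K.
Proof.
move=> /graph_isoP[f fB fM] /graph_isoP[g gB gM]; apply/graph_isoP.
by exists (g \o f); [exact: bij_comp | move=> x y /=; rewrite gM fM].
Qed.

(* A subgraph, not necessarily induced, is a pair of a vertex set and an edge
   set: the edges are edges of G with both ends in the vertex set. *)
Definition is_subgraph (G : sgraph) (S : {set G} * {set {set G}}) : bool :=
  (S.2 \subset edges G) && [forall E in S.2, E \subset S.1].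

Definition subgraph (G : sgraph) : finType :=
  {S : {set G} * {set {set G}} | is_subgraph S}.

Section SubgraphAsGraph.
Variables (G : sgraph) (S : subgraph G).

Definition sub_adj : rel {x : G | x \in (val S).1} :=
  fun x y => [set val x; val y] \in (val S).2.

Lemma sub_adj_sym : symmetric sub_adj.
Proof. by move=> x y; rewrite /sub_adj setUC. Qed.

Lemma sub_adj_irr : irreflexive sub_adj.
Proof.
move=> x; apply/negP => xS; have /andP[/subsetP sE _] := valP S.
have := sE _ xS; rewrite inE => /existsP[y /existsP[z /andP[yz /eqP Exx]]].
have: y \in [set val x; val x] by rewrite Exx !inE eqxx.
have: z \in [set val x; val x] by rewrite Exx !inE eqxx orbT.
by rewrite !inE !orbb => /eqP zx /eqP yx; rewrite zx yx adj_irr in yz.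
Qed.

Definition graph_of_subgraph : sgraph := SGraph sub_adj_sym sub_adj_irr.

End SubgraphAsGraph.

Definition independent (h : sgraph) (U : {set h}) : bool :=
  [forall x in U, forall y in U, ~~ adj x y].

(* I(\overline{K}_k)(h) *)
Definition num_indep (k : nat) (h : sgraph) : nat :=
  #|[set U : {set h} | (#|U| == k) && independent U]|.

(* I(A)(h) *)
Definition num_sub (A h : sgraph) : nat :=
  #|[set S : subgraph h | graph_iso A (graph_of_subgraph S)]|.

(* An unlabeled subgraph of K_k is an isomorphism class, within the set of
   subgraphs of K_k without isolated vertices.  The subgraph with no vertex
   is one of them; its class is the empty graph. *)
Definition unlabeled_subgraphs (k : nat) : {set {set subgraph (complete k)}} :=
  equivalence_partition
    (fun S S' => graph_iso (graph_of_subgraph S) (graph_of_subgraph S'))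
    [set S : subgraph (complete k) | no_isolated (graph_of_subgraph S)].

Lemma unlabeled_subgraphs_rep (k : nat) :
  exists rep : {set subgraph (complete k)} -> subgraph (complete k),
    forall C, C \in unlabeled_subgraphs k -> rep C \in C.
Proof.
have e0 : is_subgraph (G := complete k) (set0, set0).
  by rewrite /is_subgraph sub0set /=; apply/forallP=> E; rewrite inE.
pose S0 : subgraph (complete k) := Sub (set0, set0) e0.
exists (fun C : {set subgraph (complete k)} => odflt S0 [pick S in C]) => C.
case/imsetP=> S SD ->; case: pickP => //= /(_ S).
by rewrite !inE graph_iso_refl; move: SD; rewrite inE => ->.
Qed.

(* Main.v *)
(* Inclusion-exclusion over edge sets: a vertex set U is independent when no
   edge lies inside U, and the sum of (-1)^|F| over the sets F of edges inside
   U is 1 if there are no such edges and 0 otherwise.  Exchanging sums, each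
   edge set F of h contributes (-1)^|F| times the number of k-sets containing
   the vertices covered by F.  Edge sets F correspond to subgraphs of h without
   isolated vertices, and those on at most k vertices are exactly those
   isomorphic to a subgraph of K_k, so they can be grouped by isomorphism
   class. *)
Require Import Defs.
From mathcomp Require Import all_boot all_order all_algebra.
Import GRing.Theory.
Local Open Scope ring_scope.

(** * Edges and isomorphism invariants *)

Lemma imset_set2 (aT rT : finType) (f : aT -> rT) (x y : aT) :
  f @: [set x; y] = [set f x; f y].
Proof. by rewrite imsetU !imset_set1. Qed.

Lemma edgesP (G : sgraph) (E : {set G}) :
  reflect (exists x y, adj x y /\ E = [set x; y]) (E \in edges G).
Proof.
rewrite inE; apply: (iffP existsP) => [[x /existsP[y /andP[xy /eqP ->]]]|].
  by exists x, y.
by case=> x [y [xy ->]]; exists x; apply/existsP; exists y; rewrite xy eqxx.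
Qed.

Lemma mem_edges2 (G : sgraph) (x y : G) : ([set x; y] \in edges G) = adj x y.
Proof.
apply/edgesP/idP => [[a [b [ab e]]]|xy]; last by exists x, y.
have := set21 x y; have := set22 x y; rewrite e !inE.
have := set21 a b; have := set22 a b; rewrite -e !inE.
(* Every case either gives the same pair up to a swap or turns [ab] into a loop. *)
do 2 case/orP => /eqP ?; do 2 case/orP => /eqP ?; subst;
  by rewrite ?adj_irr // in ab *; rewrite // adj_sym.
Qed.

Lemma mem_imset_edges2 (G : sgraph) (T : finType) (f : G -> T) (x y : G) :
  injective f ->
  ([set f x; f y] \in [set f @: E | E : {set G} in edges G]) = adj x y.
Proof.
by move=> fI; rewrite -imset_set2 mem_imset ?mem_edges2 //; apply: imset_inj.
Qed.

Lemma graph_iso_card {G H : sgraph} : graph_iso G H -> #|G| = #|H|.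
Proof. by case/graph_isoP=> f /bij_eq_card. Qed.

Lemma graph_iso_nedges {G H : sgraph} : graph_iso G H -> nedges G = nedges H.
Proof.
case/graph_isoP=> f fB fM; have fI := bij_inj fB.
rewrite /nedges; suff -> : edges H = [set f @: E | E : {set G} in edges G].
  by rewrite card_imset //; apply: imset_inj.
have [g fK gK] := fB; apply/setP => E; apply/edgesP/imsetP.
  case=> x [y [xy ->]]; exists [set g x; g y]; last by rewrite imset_set2 !gK.
  by rewrite mem_edges2 -fM !gK.
case=> _ /edgesP[x [y [xy ->]] ->]; exists (f x), (f y).
by rewrite fM imset_set2.
Qed.

Lemma no_isolated_iso {G H : sgraph} :
  graph_iso G H -> no_isolated G = no_isolated H.
Proof.
suff imp K L : graph_iso K L -> no_isolated K -> no_isolated L.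
  by move=> GH; apply/idP/idP; apply: imp => //; rewrite graph_iso_sym.
case/graph_isoP=> f [g fK gK] fM /forallP niK; apply/forallP=> y.
have /existsP[z gyz] := niK (g y); apply/existsP; exists (f z).
by rewrite -[y]gK fM.
Qed.

Lemma cv_no_isolated (G : sgraph) : no_isolated G -> cv G = #|G|.
Proof.
by move/forallP=> ni; rewrite /cv; apply: eq_card => x; rewrite inE ni.
Qed.

(** * Subgraphs seen as graphs *)

Lemma card_graph_of_subgraph (G : sgraph) (S : subgraph G) :
  #|graph_of_subgraph S| = #|(val S).1|.
Proof. by rewrite card_sig; apply: eq_card => x; rewrite inE. Qed.

Lemma sub_edgeP {G : sgraph} {S : subgraph G} {E : {set G}} :
  E \in (val S).2 ->
  exists x y, [/\ x \in (val S).1, y \in (val S).1 & E = [set x; y]].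
Proof.
case/andP: (valP S) => /subsetP sE /forallP sV ES.
have /edgesP[x [y [_ eE]]] := sE _ ES; have := sV E; rewrite ES /= eE subUset.
by rewrite !sub1set => /andP[xS yS]; exists x, y.
Qed.

(** The vertices of the graph form a subtype of [G]; taking images under the inclusion [v] is
    injective on edges and reaches exactly [(val S).2]. *)
Lemma nedges_graph_of_subgraph (G : sgraph) (S : subgraph G) :
  nedges (graph_of_subgraph S) = #|(val S).2|.
Proof.
set H := graph_of_subgraph S; pose v (x : H) : G := val x.
have vI : injective v by apply: val_inj.
transitivity #|[set v @: E | E : {set H} in edges H]|.
  by rewrite card_imset //; apply: imset_inj.
apply: eq_card => E.
apply/imsetP/idP => [[_ /edgesP[x [y [xy ->]] ->]]|ES].
  by rewrite imset_set2.
have [x [y [xS yS eE]]] := sub_edgeP ES.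
exists [set (Sub x xS : H); (Sub y yS : H)]; last by rewrite imset_set2 /v !SubK.
by rewrite mem_edges2 /= /sub_adj !SubK -eE.
Qed.

(** This makes a subgraph without isolated vertices recoverable from its edge set alone. *)
Lemma no_isolated_subgraphE (G : sgraph) (S : subgraph G) :
  no_isolated (graph_of_subgraph S) = ((val S).1 == cover (val S).2).
Proof.
have sub : cover (val S).2 \subset (val S).1.
  by case/andP: (valP S) => _ /forall_inP sV; apply/bigcupsP.
rewrite eqEsubset sub andbT; apply/forallP/subsetP => [ni x xS | sV [x xS]].
  have /existsP[y xy] := ni (Sub x xS); apply/bigcupP.
  by exists [set x; val y]; rewrite ?set21.
have /bigcupP[E ES xE] := sV _ xS; apply/existsP.
have [a [b [aS bS eE]]] := sub_edgeP ES; move: ES xE; rewrite eE => ES.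
by rewrite !inE => /orP[]/eqP ?; subst x;
  [exists (Sub b bS) | exists (Sub a aS)]; rewrite /= /sub_adj !SubK // setUC.
Qed.

(** Numbering the vertices by [enum_rank] copies [G] into [complete k]. Hence every small enough
    subgraph of [h] belongs to some class in the final sum. *)
Lemma embed_complete (G : sgraph) (k : nat) :
  (#|G| <= k)%N ->
  exists T : subgraph (complete k), graph_iso (graph_of_subgraph T) G.
Proof.
move=> leGk; pose f (x : G) : complete k := widen_ord leGk (enum_rank x).
have fI : injective f by move=> x y [] /ord_inj /enum_rank_inj.
have sub : is_subgraph (G := complete k)
    ([set f x | x in [set: G]], [set f @: E | E : {set G} in edges G]).
  apply/andP; split; last first.
    by apply/forall_inP => _ /imsetP[E _ ->]; apply/imsetS/subsetT.
  apply/subsetP => _ /imsetP[_ /edgesP[x [y [xy ->]] ->]].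
  rewrite imset_set2 mem_edges2 /= -/(f x == f y) (inj_eq fI).
  by apply: contraTneq xy => ->; rewrite adj_irr.
pose T : subgraph (complete k) := Sub _ sub.
have fT x : f x \in (val T).1 by rewrite /= imset_f.
exists T; rewrite graph_iso_sym; apply/graph_isoP.
exists (fun x => Sub (f x) (fT x) : graph_of_subgraph T).
  apply: inj_card_bij => [x y /(congr1 val) /fI //|].
  by rewrite card_graph_of_subgraph /= card_imset // cardsT.
by move=> x y; rewrite /= /sub_adj /= mem_imset_edges2.
Qed.

(** * Signed sums and counts of k-sets *)

(** Expand the product of [f i + 1] over all [i], where [f] is -1 on [E] and 0 elsewhere: sets not
    inside [E] contribute 0, and any element of [E] makes the product vanish. *)
Lemma sum_signr_subsets (T : finType) (E : {set T}) :
  \sum_(F : {set T} | F \subset E) (-1) ^+ #|F| = (E == set0)%:R :> int.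
Proof.
pose f (i : T) : int := if i \in E then -1 else 0.
transitivity (\prod_i (f i + 1)).
  rewrite bigA_distr big_mkcond /=; apply: eq_bigr => F _.
  case: ifPn => [/subsetP FE | /subsetPn[x xF xE]].
    rewrite -big_mkcond /= -prodr_const; apply: eq_bigr => i /FE iE.
    by rewrite /f iE.
  by rewrite (bigD1 x) //= xF /f (negPf xE) mul0r.
have [E0 | /set0Pn[x xE]] := eqVneq E set0.
  by apply: big1 => i _; rewrite /f E0 inE add0r.
by rewrite (bigD1 x) //= /f xE addNr mul0r.
Qed.

(** Adding [W] is a bijection from the subsets of [~: W] of size [k - #|W|]. For larger [W] the
    truncated subtraction would give 1 instead of 0. *)
Lemma card_draws_above (T : finType) (W : {set T}) (k : nat) :
  (#|W| <= k)%N ->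
  #|[set U : {set T} | (#|U| == k) && (W \subset U)]| =
    'C(#|T| - #|W|, k - #|W|).
Proof.
move=> Wk; have -> : (#|T| - #|W| = #|~: W|)%N by rewrite [RHS]cardsCs setCK.
rewrite -cards_draws.
rewrite -[RHS](card_in_imset (f := fun V => V :|: W)); last first.
  have addK (V : {set T}) : V \subset ~: W -> (V :|: W) :\: W = V.
    by rewrite setDUl setDv setU0 -disjoints_subset => /setDidPl.
  move=> V1 V2; rewrite !inE => /andP[/addK V1K _] /andP[/addK V2K _] e.
  by rewrite -V1K e V2K.
apply: eq_card => U; rewrite inE; apply/andP/imsetP.
  case=> /eqP cU WU; exists (U :\: W).
    by rewrite !inE setDE subsetIr -setDE cardsD (setIidPr WU) cU /=.
  by rewrite -[LHS](setID U W) (setIidPr WU) setUC.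
case=> V; rewrite inE => /andP[VW /eqP cV] ->.
rewrite subsetUr cardsU cV; have -> : V :&: W = set0.
  by apply/disjoint_setI0; rewrite disjoints_subset.
by rewrite cards0 subn0 subnK.
Qed.

(** * Independent sets as a signed sum over edge sets, then over subgraphs *)

Lemma independentE (h : sgraph) (U : {set h}) :
  independent U = ([set E in edges h | E \subset U] == set0).
Proof.
apply/forall_inP/eqP => [ind | e0 x xU].
  apply/setP => E; rewrite inE in_set0; apply/andP => -[/edgesP[x [y [xy ->]]]].
  rewrite subUset !sub1set => /andP[xU yU].
  by have /forall_inP/(_ y yU) := ind x xU; rewrite xy.
apply/forall_inP => y yU; apply/negP => xy.
have := in_set0 [set x; y].
by rewrite -e0 inE mem_edges2 xy subUset !sub1set xU yU.
Qed.

Lemma num_indep_edge_sets (k : nat) (h : sgraph) :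
  (num_indep k h)%:Z =
    \sum_(F : {set {set h}} | (F \subset edges h) && (#|cover F| <= k)%N)
      (-1) ^+ #|F| * ('C(#|h| - #|cover F|, k - #|cover F|))%:Z.
Proof.
transitivity (\sum_(U : {set h} | #|U| == k)
    \sum_(F : {set {set h}} | (F \subset edges h) && (cover F \subset U))
      (-1) ^+ #|F| : int).
  rewrite /num_indep -sum1_card -natz natr_sum big_set /= big_mkcondr /=.
  apply: eq_bigr => U _; rewrite independentE.
  transitivity ((([set E in edges h | E \subset U] == set0)%:R : int)).
    by case: (_ == _).
  (* A set [F] consists of edges inside [U] exactly when its cover lies in [U]. *)
  rewrite -sum_signr_subsets; apply: eq_bigl => F.
  by rewrite setIdE subsetI; congr (_ && _); apply/subsetP/bigcupsP => sF E /sF;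
    rewrite inE.
rewrite (exchange_big_dep (fun F : {set {set h}} => F \subset edges h)) /=;
  last by move=> U F _ /andP[].
rewrite [RHS]big_mkcondr /=; apply: eq_bigr => F Fh; rewrite Fh /=.
rewrite sumr_const -mulr_natr; case: leqP => Wk.
  by rewrite natz -card_draws_above // cardsE.
(* No k-set contains a cover of more than k vertices. *)
rewrite (_ : #|_| = 0%N) ?mulr0 //; apply: eq_card0 => U; rewrite [LHS]/=.
apply/andP => -[/eqP cU /subset_leq_card]; rewrite cU leqNgt.
by rewrite Wk.
Qed.

Lemma num_indep_subgraphs (k : nat) (h : sgraph) :
  (num_indep k h)%:Z =
    \sum_(S : subgraph h |
          no_isolated (graph_of_subgraph S) && (#|(val S).1| <= k)%N)
      (-1) ^+ #|(val S).2| * ('C(#|h| - #|(val S).1|, k - #|(val S).1|))%:Z.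
Proof.
have sub (F : {set {set h}}) : F \subset edges h -> is_subgraph (cover F, F).
  by rewrite /is_subgraph /= => ->; apply/forall_inP => E EF; apply: bigcup_sup.
(* Default value for [insubd], taken only when [F] is not a set of edges of [h]. *)
pose S0 : subgraph h := Sub (cover set0, set0) (sub set0 (sub0set _)).
pose span F : subgraph h := insubd S0 (cover F, F).
have spanE (F : {set {set h}}) : F \subset edges h -> val (span F) = (cover F, F).
  by move/sub => sF; rewrite val_insubd sF.
rewrite num_indep_edge_sets.
rewrite (reindex_onto (fun S : subgraph h => (val S).2) span) /=; last first.
  by move=> F /andP[/spanE -> _].
have S2 (S : subgraph h) : (val S).2 \subset edges h by case/andP: (valP S).
(* The subgraphs fixed by going to the edge set and back are those without isolated vertices, so the
   reindexed sum runs over them. *)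
have S1 (S : subgraph h) :
    (span (val S).2 == S) = ((val S).1 == cover (val S).2).
  rewrite -val_eqE spanE ?S2 //=; case: (sval S) => V E.
  by rewrite xpair_eqE eqxx andbT eq_sym.
apply: eq_big => S; rewrite S2 S1 /=.
  by rewrite no_isolated_subgraphE andbC; case: eqP => [->|].
by case/andP => _ /eqP <-.
Qed.

(** * Grouping by isomorphism class *)

Theorem proposition13 (n k : nat) (h : sgraph)
    (rep : {set subgraph (complete k)} -> subgraph (complete k)) :
  (k <= n)%N -> #|h| = n ->
  (forall C, C \in unlabeled_subgraphs k -> rep C \in C) ->
  (num_indep k h)%:Z =
    \sum_(C in unlabeled_subgraphs k)
      let A := graph_of_subgraph (rep C) in
      (-1) ^+ nedges A * ('C(n - cv A, k - cv A))%:Z * (num_sub A h)%:Z.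
Proof.
move=> _ hn repP; rewrite num_indep_subgraphs hn.
pose D := [set T : subgraph (complete k) | no_isolated (graph_of_subgraph T)].
(* Defined for an arbitrary graph, so that subgraphs of [h] are also sent to classes of subgraphs of
   [complete k]. *)
pose cls (G : sgraph) := [set T in D | graph_iso G (graph_of_subgraph T)].
have eq_cls G H : graph_iso G H -> cls G = cls H.
  move=> GH; apply/setP => T; rewrite !inE; congr (_ && _).
  by apply/idP/idP; apply: graph_iso_trans; rewrite // graph_iso_sym.
have mem_cls T G : T \in cls G -> T \in D /\ graph_iso G (graph_of_subgraph T).
  by rewrite /cls inE => /andP[].
have unlabeledE T : T \in D -> cls (graph_of_subgraph T) \in unlabeled_subgraphs k.
  exact: imset_f.
(* A class is recovered from any of its members, so the choice made by [rep] is harmless. *)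
have clsP C : C \in unlabeled_subgraphs k ->
    rep C \in D /\ C = cls (graph_of_subgraph (rep C)).
  move=> CU; have := repP C CU; have [T _ defC] := imsetP CU.
  rewrite {2}defC => /mem_cls[rD Tr]; split=> //.
  by rewrite {1}defC -(eq_cls _ _ Tr).
rewrite (partition_big (fun S => cls (graph_of_subgraph S))
   (mem (unlabeled_subgraphs k))) /=; last first.
  move=> S /andP[niS Sk]; have [|T TS] := @embed_complete (graph_of_subgraph S) k.
    by rewrite card_graph_of_subgraph.
  by rewrite -(eq_cls _ _ TS) unlabeledE // inE (no_isolated_iso TS).
apply: eq_bigr => C CU; have [rD defC] := clsP C CU.
set A := graph_of_subgraph (rep C).
have niA : no_isolated A by move: rD; rewrite inE.
have cA : (#|A| <= k)%N.
  by rewrite card_graph_of_subgraph -[leqRHS]card_ord max_card.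
(* Being isomorphic to [A] already forces the absence of isolated vertices and the bound k on the
   order. *)
rewrite (eq_bigl (fun S => graph_iso A (graph_of_subgraph S))); last first.
  move=> S; apply/idP/idP => [/andP[_ /eqP clsS] | AS].
    have : rep C \in cls (graph_of_subgraph S) by rewrite clsS repP.
    by case/mem_cls; rewrite graph_iso_sym.
  rewrite -(no_isolated_iso AS) niA -card_graph_of_subgraph -(graph_iso_card AS).
  by rewrite cA -(eq_cls _ _ AS) -defC eqxx.
(* The summand depends only on the isomorphism type, so it is constant on the class and factors out
   of the count of copies of [A]. *)
rewrite (cv_no_isolated _ niA) /num_sub -sum1_card -[X in _ * X]natz natr_sum.
rewrite mulr_sumr; apply: eq_big => [S | S AS]; first by rewrite inE.
by rewrite mulr1 (graph_iso_nedges AS) nedges_graph_of_subgraph (graph_iso_card AS)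
  card_graph_of_subgraph.
Qed.
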